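(* Let $\alpha\neq 0$ be a real number and let $\vec v\in\mathbb R_1^3$. If $\Sigma\subset\mathbb R_1^3$ is a rotational timelike $K^\alpha$-translator with speed $\vec v$ (with timelike, spacelike or lightlike rotation axis), then $\vec v$ is parallel to the rotation axis of $\Sigma$.
   Context: $\mathbb R_1^3$ is $\mathbb R^3$ with the metric $\langle,\rangle=dx^2+dy^2-dz^2$. A surface is timelike if its induced metric is Lorentzian; then its (local) unit normal $N$ satisfies $\langle N,N\rangle=\epsilon=1$. The Gauss curvature is $K=\epsilon\det(A)$, where $AU=-\nabla^0_U N$ is the Weingarten map and $\nabla^0$ is the Levi-Civita connection of $\mathbb R_1^3$. In a local parametrization $X(u,v)$, $$K=-\frac{\det(X_u,X_v,X_{uu})\det(X_u,X_v,X_{vv})-\det(X_u,X_v,X_{uv})^2}{(EG-F^2)^2},$$ where $E=\langle X_u,X_u\rangle$, $F=\langle X_u,X_v\rangle$, $G=\langle X_v,X_v\rangle$. A timelike surface is a timelike $K^\alpha$-translator with speed $\vec v$ if $K>0$ and $K^\alpha=\langle N,\vec v\rangle$ everywhere, for a choice of unit normal $N$. A surface of revolution is, after a rigid motion of $\mathbb R_1^3$, one of the following, with $f$ smooth on an interval of $r>0$: - timelike axis spanned by $(0,0,1)$: $X(r,\theta)=(r\cos\theta,r\sin\theta,f(r))$, timelike iff $f'^2>1$; - spacelike axis spanned by $(1,0,0)$: either $X(r,\theta)=(f(r),r\sinh\theta,r\cosh\theta)$, timelike iff $f'^2<1$, or $X(r,\theta)=(f(r),r\cosh\theta,r\sinh\theta)$,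 always timelike; - lightlike axis spanned by $(0,1,1)$: $X(r,t)=(2rt,f(r)+r-rt^2,f(r)-r-rt^2)$, timelike iff $f'<0$. *)

(* Defs.v *)
From Stdlib Require Import Reals.
From Coquelicot Require Import Coquelicot.
Open Scope R_scope.

(** * Lorentz-Minkowski space with the metric dx^2 + dy^2 - dz^2 *)

Definition vec : Type := (R * R * R)%type.

Definition vx (p : vec) : R := fst (fst p).
Definition vy (p : vec) : R := snd (fst p).
Definition vz (p : vec) : R := snd p.

Definition ldot (p q : vec) : R := vx p * vx q + vy p * vy q - vz p * vz q.

(** Linear part of a rigid motion; both orientations and both time
    orientations are allowed. *)
Definition lorentz_linear_isometry (L : vec -> vec) : Prop :=
  is_linear L /\ forall p q : vec, ldot (L p) (L q) = ldot p q.

Definition parallel (w a : vec) : Prop := exists c : R, w = scal c a.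

(** * Parametrized surfaces and vector fields along them

    A surface is given by a map [X : R -> R -> vec] of which only the
    restriction to the domain [D] matters. *)

Definition smooth_on (D : R -> R -> Prop) (Y : R -> R -> vec) : Prop :=
  forall u v, D u v -> forall n : nat,
    ex_diff_n (fun s t => vx (Y s t)) n u v /\
    ex_diff_n (fun s t => vy (Y s t)) n u v /\
    ex_diff_n (fun s t => vz (Y s t)) n u v.

Definition d_u (Y : R -> R -> vec) (u v : R) : vec :=
  (Derive (fun s => vx (Y s v)) u,
   Derive (fun s => vy (Y s v)) u,
   Derive (fun s => vz (Y s v)) u).

Definition d_v (Y : R -> R -> vec) (u v : R) : vec :=
  (Derive (fun t => vx (Y u t)) v,
   Derive (fun t => vy (Y u t)) v,
   Derive (fun t => vz (Y u t)) v).

Definition tangent (X : R -> R -> vec) (u v : R) (e : vec) : Prop :=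
  exists a b : R, e = plus (scal a (d_u X u v)) (scal b (d_v X u v)).

(** The induced metric has signature (1,1). Such [e1], [e2] are linearly
    independent, so this makes [X] an immersion at [(u,v)]. *)
Definition lorentzian_at (X : R -> R -> vec) (u v : R) : Prop :=
  exists e1 e2 : vec,
    tangent X u v e1 /\ tangent X u v e2 /\
    ldot e1 e1 = 1 /\ ldot e2 e2 = -1 /\ ldot e1 e2 = 0.

Definition timelike_surface (D : R -> R -> Prop) (X : R -> R -> vec) : Prop :=
  open (fun p : R * R => D (fst p) (snd p)) /\
  smooth_on D X /\
  forall u v, D u v -> lorentzian_at X u v.

Definition unit_normal (D : R -> R -> Prop) (X N : R -> R -> vec) : Prop :=
  smooth_on D N /\
  forall u v, D u v ->
    ldot (N u v) (d_u X u v) = 0 /\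
    ldot (N u v) (d_v X u v) = 0 /\
    ldot (N u v) (N u v) = 1.

(** [[a b; c d]] is the matrix in the basis [(X_u, X_v)] of the Weingarten map
    [A U = - nabla^0_U N]. The connection [nabla^0] is flat, so
    [nabla^0_{X_u} N = N_u] and [nabla^0_{X_v} N = N_v]. *)
Definition weingarten_matrix (X N : R -> R -> vec) (u v a b c d : R) : Prop :=
  opp (d_u N u v) = plus (scal a (d_u X u v)) (scal c (d_v X u v)) /\
  opp (d_v N u v) = plus (scal b (d_u X u v)) (scal d (d_v X u v)).

(** [K = epsilon * det A] with [epsilon = <N,N>]; the value [K] is unique where
    [X] is an immersion. *)
Definition is_gauss_curvature (X N : R -> R -> vec) (u v K : R) : Prop :=
  exists a b c d : R,
    weingarten_matrix X N u v a b c d /\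
    K = ldot (N u v) (N u v) * (a * d - b * c).

Definition timelike_translator (alpha : R) (w : vec)
    (D : R -> R -> Prop) (X : R -> R -> vec) : Prop :=
  timelike_surface D X /\
  exists N : R -> R -> vec,
    unit_normal D X N /\
    forall u v, D u v ->
      exists K : R,
        is_gauss_curvature X N u v K /\
        0 < K /\
        Rpower K alpha = ldot (N u v) w.

(** * Surfaces of revolution *)

Inductive rotation_model : Set :=
  | timelike_axis
  | spacelike_axis_sinh_cosh
  | spacelike_axis_cosh_sinh
  | lightlike_axis.

Definition model_axis (m : rotation_model) : vec :=
  match m with
  | timelike_axis => (0, 0, 1)
  | spacelike_axis_sinh_cosh => (1, 0, 0)
  | spacelike_axis_cosh_sinh => (1, 0, 0)
  | lightlike_axis => (0, 1, 1)
  end.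

Definition model_surface (m : rotation_model) (f : R -> R) (r t : R) : vec :=
  match m with
  | timelike_axis => (r * cos t, r * sin t, f r)
  | spacelike_axis_sinh_cosh => (f r, r * sinh t, r * cosh t)
  | spacelike_axis_cosh_sinh => (f r, r * cosh t, r * sinh t)
  | lightlike_axis => (2 * r * t, f r + r - r * t ^ 2, f r - r - r * t ^ 2)
  end.

Definition positive_open_interval (I : R -> Prop) : Prop :=
  open I /\
  (exists r, I r) /\
  (forall r, I r -> 0 < r) /\
  (forall r1 r2 r, I r1 -> I r2 -> r1 <= r <= r2 -> I r).

(** [X], on the domain [D], is a surface of revolution: the image of a model
    under the rigid motion [p |-> L p + q]. Its rotation axis is the line
    through [q] with direction [axis]. *)
Definition rotational_surface (D : R -> R -> Prop) (X : R -> R -> vec)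
    (axis : vec) : Prop :=
  exists (m : rotation_model) (f : R -> R) (I : R -> Prop)
         (L : vec -> vec) (q : vec),
    positive_open_interval I /\
    (forall r, I r -> forall n : nat, ex_derive_n f n r) /\
    lorentz_linear_isometry L /\
    (forall r t, D r t <-> I r) /\
    (forall r t, D r t -> X r t = plus (L (model_surface m f r t)) q) /\
    axis = L (model_axis m).

(* Main.v *)
(** The square of [<N,w>] is [- det (X_u, X_v, w)^2 / W] with [W = EG - F^2 < 0],
    and [K] is given by the determinant formula. Along a circle of revolution
    [K] and [W] are constant, so [K^alpha = <N,w>] forces [det (X_u, X_v, w)^2]
    to be constant there. This determinant is a trigonometric, hyperbolic or
    plain polynomial of degree at most 2 in the rotation parameter, and its square
    can only be constant if its non-constant coefficients vanish. Since [K > 0]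
    excludes [f' = 0] when the axis is not lightlike, this kills the components of
    [w] transverse to the axis. *)
Require Import Defs.
From Stdlib Require Import Reals Lra.
From Coquelicot Require Import Coquelicot.
Open Scope R_scope.

Lemma vec_ext (p q : vec) :
  vx p = vx q -> vy p = vy q -> vz p = vz q -> p = q.
Proof.
destruct p as [[p1 p2] p3], q as [[q1 q2] q3]; unfold vx, vy, vz; simpl.
now intros -> -> ->.
Qed.

Lemma vec_eta (p : vec) : p = (vx p, vy p, vz p).
Proof. now destruct p as [[p1 p2] p3]. Qed.

(** * Determinants and Lorentzian Gram matrices *)

Definition det3 (a b c : vec) : R :=
  vx a * (vy b * vz c - vz b * vy c)
  - vy a * (vx b * vz c - vz b * vx c)
  + vz a * (vx b * vy c - vy b * vx c).

Definition gram2 (a b : vec) : R := ldot a a * ldot b b - ldot a b ^ 2.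

(** The metric has determinant -1, so the left side is minus the determinant of the pairings of
    [a, b, n] with [a, b, y]. Orthogonality leaves only [ldot n y] in the row of [n]. *)
Lemma det3_mul_normal (a b n y : vec) :
  ldot n a = 0 -> ldot n b = 0 ->
  det3 a b n * det3 a b y = - gram2 a b * ldot n y.
Proof.
intros ha hb.
transitivity
  (- gram2 a b * ldot n y
   + ldot n a * (ldot b b * ldot a y - ldot a b * ldot b y)
   - ldot n b * (ldot a b * ldot a y - ldot a a * ldot b y)).
- unfold det3, gram2, ldot; ring.
- rewrite ha, hb; ring.
Qed.

(** The case [y = n] of the previous lemma gives [det3 a b n ^ 2 = - gram2 a b]. Multiplying the
    cases [y] and [z] and cancelling this factor removes the normal's orientation. *)
Lemma det3_mul_det3 (a b n y z : vec) :
  ldot n a = 0 -> ldot n b = 0 -> ldot n n = 1 -> gram2 a b <> 0 ->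
  det3 a b y * det3 a b z = - gram2 a b * (ldot n y * ldot n z).
Proof.
intros ha hb hn hW.
pose proof (det3_mul_normal a b n n ha hb) as Hn.
pose proof (det3_mul_normal a b n y ha hb) as Hy.
pose proof (det3_mul_normal a b n z ha hb) as Hz.
rewrite hn, Rmult_1_r in Hn.
apply (Rmult_eq_reg_l (- gram2 a b)); [| lra].
rewrite <- Hn at 1.
transitivity ((det3 a b n * det3 a b y) * (det3 a b n * det3 a b z)); [ring |].
rewrite Hy, Hz; ring.
Qed.

(** A change of tangent basis multiplies the Gram determinant by a square, and the basis [e1, e2]
    has Gram determinant -1. *)
Lemma lorentzian_gram2_neg (X : R -> R -> vec) (u v : R) :
  lorentzian_at X u v -> gram2 (d_u X u v) (d_v X u v) < 0.
Proof.
intros (e1 & e2 & (a & b & E1) & (c & d & E2) & h1 & h2 & h12).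
set (A := d_u X u v) in *; set (B := d_v X u v) in *.
assert (H : gram2 e1 e2 = (a * d - b * c) ^ 2 * gram2 A B).
{ rewrite E1, E2; unfold gram2, ldot, vx, vy, vz; simpl.
  unfold plus, scal, mult; simpl; unfold mult; simpl; ring. }
unfold gram2 at 1 in H; rewrite h1, h2, h12 in H.
destruct (Rlt_or_le (gram2 A B) 0) as [|hp]; [assumption |].
pose proof (Rmult_le_pos _ _ (pow2_ge_0 (a * d - b * c)) hp); lra.
Qed.

(** The second fundamental form is the first one composed with the Weingarten map; taking
    determinants gives the formula for K. The last four hypotheses are the derivatives of
    [<N,X_u> = 0] and [<N,X_v> = 0]. *)
Lemma gauss_curvature_det3 (n A B Nu Nv Xuu Xuv Xvv : vec) (a b c d : R) :
  ldot n A = 0 -> ldot n B = 0 -> ldot n n = 1 -> gram2 A B <> 0 ->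
  opp Nu = plus (scal a A) (scal c B) ->
  opp Nv = plus (scal b A) (scal d B) ->
  ldot Nu A + ldot n Xuu = 0 -> ldot Nu B + ldot n Xuv = 0 ->
  ldot Nv A + ldot n Xuv = 0 -> ldot Nv B + ldot n Xvv = 0 ->
  (a * d - b * c) * gram2 A B ^ 2 =
  det3 A B Xuv ^ 2 - det3 A B Xuu * det3 A B Xvv.
Proof.
intros hA hB hn hW hu hv huu huv hvu hvv.
assert (comb : forall x y e p, opp p = plus (scal x A) (scal y B) ->
          - ldot p e = x * ldot A e + y * ldot B e).
{ intros x y e p H.
  transitivity (ldot (opp p) e).
  - unfold ldot, vx, vy, vz; simpl; unfold opp; simpl; ring.
  - rewrite H; unfold ldot, vx, vy, vz; simpl.
    unfold plus, scal, mult; simpl; unfold mult; simpl; ring. }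
pose proof (comb _ _ A _ hu) as huA; pose proof (comb _ _ B _ hu) as huB.
pose proof (comb _ _ A _ hv) as hvA; pose proof (comb _ _ B _ hv) as hvB.
assert (sym : ldot B A = ldot A B) by (unfold ldot; ring).
rewrite sym in huA, hvA.
replace (det3 A B Xuv ^ 2) with (det3 A B Xuv * det3 A B Xuv) by ring.
rewrite !(det3_mul_det3 A B n) by assumption.
assert (e1 : ldot n Xuu = a * ldot A A + c * ldot A B) by lra.
assert (e2 : ldot n Xvv = b * ldot A B + d * ldot B B) by lra.
assert (e3 : ldot n Xuv = a * ldot A B + c * ldot B B) by lra.
assert (e4 : ldot n Xuv = b * ldot A A + d * ldot A B) by lra.
(* The two factors [ldot n Xuv] are the two off-diagonal entries, so each gets its own expression;
   the identity is then multiplicativity of 2 by 2 determinants. *)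
rewrite e1, e2, e3 at 1; rewrite e4; unfold gram2; ring.
Qed.

(** * Derivatives of curves *)

Definition is_vderive (c : R -> vec) (t : R) (l : vec) : Prop :=
  is_derive (fun s => vx (c s)) t (vx l) /\
  is_derive (fun s => vy (c s)) t (vy l) /\
  is_derive (fun s => vz (c s)) t (vz l).

Lemma is_vderive_unique (c : R -> vec) (t : R) (l : vec) :
  is_vderive c t l ->
  (Derive (fun s => vx (c s)) t, Derive (fun s => vy (c s)) t,
   Derive (fun s => vz (c s)) t) = l.
Proof.
intros (h1 & h2 & h3); rewrite (vec_eta l).
repeat f_equal; now apply is_derive_unique.
Qed.

Lemma is_vderive_ext_loc (c c' : R -> vec) (t : R) (l : vec) :
  locally t (fun s => c s = c' s) -> is_vderive c t l -> is_vderive c' t l.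
Proof.
intros H (h1 & h2 & h3); split; [| split];
  [ refine (is_derive_ext_loc _ _ _ _ _ h1) | refine (is_derive_ext_loc _ _ _ _ _ h2)
  | refine (is_derive_ext_loc _ _ _ _ _ h3) ];
  revert H; apply filter_imp; now intros s ->.
Qed.

Lemma smooth_on_d_u (D : R -> R -> Prop) (Y : R -> R -> vec) (u v : R) :
  smooth_on D Y -> D u v -> is_vderive (fun s => Y s v) u (d_u Y u v).
Proof.
intros H h; destruct (H u v h 1%nat) as ((_ & h1 & _) & (_ & h2 & _) & (_ & h3 & _)).
now split; [| split]; apply Derive_correct.
Qed.

Lemma smooth_on_d_v (D : R -> R -> Prop) (Y : R -> R -> vec) (u v : R) :
  smooth_on D Y -> D u v -> is_vderive (fun t => Y u t) v (d_v Y u v).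
Proof.
intros H h; destruct (H u v h 1%nat)
  as ((_ & _ & h1 & _) & (_ & _ & h2 & _) & (_ & _ & h3 & _)).
now split; [| split]; apply Derive_correct.
Qed.

Lemma is_vderive_orthogonal (n y : R -> vec) (t : R) (n' y' : vec) :
  is_vderive n t n' -> is_vderive y t y' ->
  locally t (fun s => ldot (n s) (y s) = 0) ->
  ldot n' (y t) + ldot (n t) y' = 0.
Proof.
intros (n1 & n2 & n3) (y1 & y2 & y3) H.
assert (h1 : is_derive (fun s => ldot (n s) (y s)) t
               (ldot n' (y t) + ldot (n t) y')).
{ unfold ldot.
  pose proof (is_derive_minus _ _ _ _ _
    (is_derive_plus _ _ _ _ _
      (is_derive_mult _ _ _ _ _ n1 y1 Rmult_comm)
      (is_derive_mult _ _ _ _ _ n2 y2 Rmult_comm))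
    (is_derive_mult _ _ _ _ _ n3 y3 Rmult_comm)) as h.
  eapply is_derive_ext; [| eapply eq_rect; [exact h |]].
  - reflexivity.
  - unfold minus, plus, opp, mult; simpl; ring. }
apply is_derive_unique in h1; rewrite <- h1.
rewrite (Derive_ext_loc _ (fun _ => 0)); [apply Derive_const | exact H].
Qed.

(** * Linear isometries *)

Lemma linear_coords (L : vec -> vec) (p : vec) : is_linear L ->
  L p = plus (scal (vx p) (L (1, 0, 0)))
             (plus (scal (vy p) (L (0, 1, 0))) (scal (vz p) (L (0, 0, 1)))).
Proof.
intros hL; rewrite <- !(linear_scal L hL), <- !(linear_plus L hL); f_equal.
apply vec_ext; unfold vx, vy, vz; simpl;
  unfold plus, scal, mult; simpl; unfold mult; simpl; ring.
Qed.

Lemma is_derive_comb3 (c1 c2 c3 : R -> R) (t l1 l2 l3 k1 k2 k3 k : R) :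
  is_derive c1 t l1 -> is_derive c2 t l2 -> is_derive c3 t l3 ->
  is_derive (fun s => c1 s * k1 + (c2 s * k2 + c3 s * k3) + k) t
    (l1 * k1 + (l2 * k2 + l3 * k3)).
Proof.
intros h1 h2 h3; auto_derive.
- repeat split; eexists; eassumption.
- rewrite (is_derive_unique (fun s : R => c1 s) _ _ h1),
    (is_derive_unique (fun s : R => c2 s) _ _ h2),
    (is_derive_unique (fun s : R => c3 s) _ _ h3); ring.
Qed.

Lemma is_vderive_affine (L : vec -> vec) (q : vec) (c : R -> vec) (t : R) (l : vec) :
  is_linear L -> is_vderive c t l ->
  is_vderive (fun s => plus (L (c s)) q) t (L l).
Proof.
intros hL (h1 & h2 & h3).
rewrite (linear_coords L l hL); split; [| split];
  (eapply is_derive_ext;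
   [ intros s; rewrite (linear_coords L (c s) hL); reflexivity | now apply is_derive_comb3 ]).
Qed.

Definition ldet (L : vec -> vec) : R := det3 (L (1, 0, 0)) (L (0, 1, 0)) (L (0, 0, 1)).

Lemma det3_linear (L : vec -> vec) (a b c : vec) : is_linear L ->
  det3 (L a) (L b) (L c) = ldet L * det3 a b c.
Proof.
intros hL; rewrite (linear_coords L a hL), (linear_coords L b hL),
  (linear_coords L c hL).
unfold ldet, det3, vx, vy, vz; simpl.
unfold plus, scal, mult; simpl; unfold mult; simpl; ring.
Qed.

(** The squared determinant is minus the Gram determinant of the image basis, whose Gram matrix is
    diag(1, 1, -1); hence it equals 1. *)
Lemma isometry_ldet_neq0 (L : vec -> vec) : lorentz_linear_isometry L -> ldet L <> 0.
Proof.
intros (hL & iL) h0.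
pose proof (iL (1, 0, 0) (1, 0, 0)) as h11; pose proof (iL (0, 1, 0) (0, 1, 0)) as h22.
pose proof (iL (0, 0, 1) (0, 0, 1)) as h33; pose proof (iL (1, 0, 0) (0, 1, 0)) as h12.
pose proof (iL (1, 0, 0) (0, 0, 1)) as h13; pose proof (iL (0, 1, 0) (0, 0, 1)) as h23.
unfold ldet in h0.
set (a := L (1, 0, 0)) in *; set (b := L (0, 1, 0)) in *; set (c := L (0, 0, 1)) in *.
assert (H : det3 a b c ^ 2 =
  - (ldot a a * (ldot b b * ldot c c - ldot b c ^ 2)
     - ldot a b * (ldot a b * ldot c c - ldot b c * ldot a c)
     + ldot a c * (ldot a b * ldot b c - ldot b b * ldot a c))).
{ unfold det3, ldot; ring. }
rewrite h0, h11, h22, h33, h12, h13, h23 in H.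
unfold ldot, vx, vy, vz in H; simpl in H; lra.
Qed.

Lemma isometry_surjective (L : vec -> vec) (w : vec) :
  lorentz_linear_isometry L -> exists w', w = L w'.
Proof.
intros H; pose proof (isometry_ldet_neq0 L H) as hd; destruct H as [hL _].
(* Cramer's rule. *)
exists (det3 w (L (0, 1, 0)) (L (0, 0, 1)) / ldet L,
        det3 (L (1, 0, 0)) w (L (0, 0, 1)) / ldet L,
        det3 (L (1, 0, 0)) (L (0, 1, 0)) w / ldet L).
rewrite (linear_coords L _ hL).
unfold ldet, det3 in hd |- *.
apply vec_ext; unfold vx, vy, vz in *; simpl in *;
  unfold plus, scal, mult; simpl; unfold mult; simpl; field; exact hd.
Qed.

Lemma gram2_isometry (L : vec -> vec) (a b : vec) :
  lorentz_linear_isometry L -> gram2 (L a) (L b) = gram2 a b.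
Proof. intros (_ & iL); unfold gram2; now rewrite !iL. Qed.

(** * Derivatives of the models *)

(** In the following five definitions [p] and [h] are the values of [f'] and [f'']. *)

Definition model_u (m : rotation_model) (p r t : R) : vec :=
  match m with
  | timelike_axis => (cos t, sin t, p)
  | spacelike_axis_sinh_cosh => (p, sinh t, cosh t)
  | spacelike_axis_cosh_sinh => (p, cosh t, sinh t)
  | lightlike_axis => (2 * t, p + 1 - t ^ 2, p - 1 - t ^ 2)
  end.

Definition model_v (m : rotation_model) (r t : R) : vec :=
  match m with
  | timelike_axis => (- r * sin t, r * cos t, 0)
  | spacelike_axis_sinh_cosh => (0, r * cosh t, r * sinh t)
  | spacelike_axis_cosh_sinh => (0, r * sinh t, r * cosh t)
  | lightlike_axis => (2 * r, - 2 * r * t, - 2 * r * t)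
  end.

Definition model_uu (m : rotation_model) (h : R) : vec :=
  match m with
  | timelike_axis => (0, 0, h)
  | spacelike_axis_sinh_cosh => (h, 0, 0)
  | spacelike_axis_cosh_sinh => (h, 0, 0)
  | lightlike_axis => (0, h, h)
  end.

Definition model_uv (m : rotation_model) (t : R) : vec :=
  match m with
  | timelike_axis => (- sin t, cos t, 0)
  | spacelike_axis_sinh_cosh => (0, cosh t, sinh t)
  | spacelike_axis_cosh_sinh => (0, sinh t, cosh t)
  | lightlike_axis => (2, - 2 * t, - 2 * t)
  end.

Definition model_vv (m : rotation_model) (r t : R) : vec :=
  match m with
  | timelike_axis => (- r * cos t, - r * sin t, 0)
  | spacelike_axis_sinh_cosh => (0, r * sinh t, r * cosh t)
  | spacelike_axis_cosh_sinh => (0, r * cosh t, r * sinh t)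
  | lightlike_axis => (0, - 2 * r, - 2 * r)
  end.

Ltac prove_vderive :=
  split; [| split]; unfold vx, vy, vz; simpl; unfold sinh, cosh;
  auto_derive; auto; try (unfold Rdiv; ring).

Lemma is_vderive_model_u (m : rotation_model) (f : R -> R) (r t p : R) :
  is_derive f r p ->
  is_vderive (fun s => model_surface m f s t) r (model_u m p r t).
Proof.
intros hf; pose proof (is_derive_unique (fun s : R => f s) _ _ hf) as e.
assert (ex : ex_derive f r) by (eexists; exact hf).
destruct m; prove_vderive; rewrite e; unfold Rdiv; ring.
Qed.

Lemma is_vderive_model_v (m : rotation_model) (f : R -> R) (r t : R) :
  is_vderive (fun s => model_surface m f r s) t (model_v m r t).
Proof. destruct m; prove_vderive. Qed.

(** Here [g] stands for [f']: the slope must vary with the parameter when differentiating a second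
    time. *)
Lemma is_vderive_model_uu (m : rotation_model) (g : R -> R) (r t h : R) :
  is_derive g r h -> is_vderive (fun s => model_u m (g s) s t) r (model_uu m h).
Proof.
intros hg; pose proof (is_derive_unique (fun s : R => g s) _ _ hg) as e.
assert (ex : ex_derive g r) by (eexists; exact hg).
destruct m; prove_vderive; rewrite e; unfold Rdiv; ring.
Qed.

Lemma is_vderive_model_uv (m : rotation_model) (p r t : R) :
  is_vderive (fun s => model_u m p r s) t (model_uv m t).
Proof. destruct m; prove_vderive. Qed.

Lemma is_vderive_model_vu (m : rotation_model) (r t : R) :
  is_vderive (fun s => model_v m s t) r (model_uv m t).
Proof. destruct m; prove_vderive. Qed.

Lemma is_vderive_model_vv (m : rotation_model) (r t : R) :
  is_vderive (fun s => model_v m r s) t (model_vv m r t).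
Proof. destruct m; prove_vderive. Qed.

(** * Rotation invariance of the models *)

Lemma cos_sqr (t : R) : cos t ^ 2 = 1 - sin t ^ 2.
Proof. pose proof (sin2_cos2 t) as H; unfold Rsqr in H; lra. Qed.

Lemma cosh_sqr (t : R) : cosh t ^ 2 = 1 + sinh t ^ 2.
Proof.
pose proof (exp_plus t (- t)) as H; rewrite Rplus_opp_r, exp_0 in H.
unfold cosh, sinh.
transitivity (((exp t - exp (- t)) / 2) ^ 2 + exp t * exp (- t)); [field |].
rewrite <- H; ring.
Qed.

(** Changing [t] applies a Lorentz rotation about the axis, so [t] drops out. *)
Lemma gram2_model (m : rotation_model) (p r t : R) :
  gram2 (model_u m p r t) (model_v m r t) =
  match m with
  | timelike_axis => (1 - p ^ 2) * r ^ 2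
  | spacelike_axis_sinh_cosh => (p ^ 2 - 1) * r ^ 2
  | spacelike_axis_cosh_sinh => - (p ^ 2 + 1) * r ^ 2
  | lightlike_axis => 16 * p * r ^ 2
  end.
Proof.
pose proof (cos_sqr t) as hc; pose proof (cosh_sqr t) as hh.
destruct m; unfold gram2, ldot, vx, vy, vz; simpl fst; simpl snd; ring [hc hh].
Qed.

Definition model_curvature_numerator (m : rotation_model) (p h r t : R) : R :=
  det3 (model_u m p r t) (model_v m r t) (model_uv m t) ^ 2
  - det3 (model_u m p r t) (model_v m r t) (model_uu m h)
    * det3 (model_u m p r t) (model_v m r t) (model_vv m r t).

Lemma model_curvature_numeratorE (m : rotation_model) (p h r t : R) :
  model_curvature_numerator m p h r t =
  match m with
  | timelike_axis => - (r ^ 3 * p * h)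
  | spacelike_axis_sinh_cosh => r ^ 3 * p * h
  | spacelike_axis_cosh_sinh => r ^ 3 * p * h
  | lightlike_axis => 32 * r ^ 3 * h
  end.
Proof.
pose proof (cos_sqr t) as hc; pose proof (cosh_sqr t) as hh.
destruct m; unfold model_curvature_numerator, det3, vx, vy, vz;
  simpl fst; simpl snd; ring [hc hh].
Qed.

(** * Expressions with constant square *)

Lemma trig_sqr_const (a b c s : R) :
  (forall t, (a * cos t + b * sin t + c) ^ 2 = s) -> a = 0 /\ b = 0.
Proof.
intros H.
(* Comparing 0 with PI gives [a * c = 0], PI/2 with -PI/2 gives [b * c = 0], PI/4 with -PI/4 then
   gives [a * b = 0], and 0 with PI/2 gives [a ^ 2 = b ^ 2]. *)
pose proof (H 0) as h0; pose proof (H PI) as h1; pose proof (H (PI / 2)) as h2.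
pose proof (H (- (PI / 2))) as h3; pose proof (H (PI / 4)) as h4.
pose proof (H (- (PI / 4))) as h5.
rewrite cos_0, sin_0 in h0; rewrite cos_PI, sin_PI in h1.
rewrite cos_PI2, sin_PI2 in h2; rewrite cos_neg, sin_neg, cos_PI2, sin_PI2 in h3.
rewrite cos_PI4, sin_PI4 in h4; rewrite cos_neg, sin_neg, cos_PI4, sin_PI4 in h5.
set (k := 1 / sqrt 2) in *.
assert (hk : k ^ 2 = 1 / 2).
{ unfold k; pose proof (sqrt_sqrt 2 ltac:(lra)) as e.
  pose proof (sqrt_lt_R0 2 ltac:(lra)).
  transitivity (1 / (sqrt 2 * sqrt 2)); [field; lra | rewrite e; reflexivity]. }
assert (hac : a * c = 0) by lra.
assert (hbc : b * c = 0) by lra.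
assert (hab : a * b = 0).
{ transitivity (2 * (k ^ 2 * (a * b))); [rewrite hk; field |].
  assert (k * (b * c) = 0) by (rewrite hbc; ring). lra. }
assert (hs : a ^ 2 = b ^ 2) by lra.
assert (h6 : (a * k + b * k + c) ^ 2 =
  k ^ 2 * (a ^ 2 + b ^ 2) + 2 * k ^ 2 * (a * b)
  + 2 * k * (a * c) + 2 * k * (b * c) + c ^ 2) by ring.
rewrite hk, hac, hbc, hab in h6.
assert (haa : a * (a * a) = 0).
{ transitivity (a * a ^ 2); [ring |]. rewrite hs.
  transitivity (a * b * b); [ring |]. rewrite hab; ring. }
assert (ha : a = 0).
{ destruct (Rmult_integral _ _ haa) as [| h]; [assumption |].
  destruct (Rmult_integral _ _ h); assumption. }
split; [assumption |].
rewrite ha in hs.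
assert (hb : b * b = 0) by lra.
destruct (Rmult_integral _ _ hb); assumption.
Qed.

Lemma exp_opp_ln (x : R) : 0 < x -> exp (- ln x) = / x.
Proof. intros hx; rewrite exp_Ropp, exp_ln; [reflexivity | exact hx]. Qed.

Lemma hyp_sqr_const (a b c s : R) :
  (forall t, (a * cosh t + b * sinh t + c) ^ 2 = s) -> a = 0 /\ b = 0.
Proof.
intros H.
pose proof (H 0) as h0; pose proof (H (ln 2)) as h2; pose proof (H (- ln 2)) as h2'.
pose proof (H (ln 3)) as h3; pose proof (H (- ln 3)) as h3'.
unfold cosh, sinh in *.
rewrite Ropp_0, exp_0 in h0.
rewrite Ropp_involutive in h2', h3'.
rewrite exp_opp_ln, exp_ln in h2, h2', h3, h3' by lra.
(* The values at [t] and [-t] differ by [4 * b * sinh t * (a * cosh t + c)]. Since cosh is 5/4 at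
   [ln 2] and 5/3 at [ln 3], the two equations separate [a * b] from [b * c]. *)
assert (hb2 : b * (5 / 4 * a + c) = 0) by lra.
assert (hb3 : b * (5 / 3 * a + c) = 0) by lra.
assert (hab : a * b = 0) by lra.
assert (hcb : b * c = 0) by lra.
assert (hb : b = 0).
{ destruct (Req_dec b 0) as [| nb]; [assumption | exfalso].
  assert (ha : a = 0) by (destruct (Rmult_integral _ _ hab); [assumption | contradiction]).
  assert (hc : c = 0) by (destruct (Rmult_integral _ _ hcb); [contradiction | assumption]).
  rewrite ha, hc in h0, h2.
  assert (hbb : b * b = 0) by lra.
  destruct (Rmult_integral _ _ hbb); contradiction. }
rewrite hb in *; split; [| reflexivity].
(* Now [(a * x + c) ^ 2] agrees at x = 1, 5/4, 5/3, so its leading coefficient vanishes. *)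
assert (haa : a * a = 0) by lra.
destruct (Rmult_integral _ _ haa); assumption.
Qed.

Lemma quad_sqr_const (a b c s : R) :
  (forall t, (a * t ^ 2 + b * t + c) ^ 2 = s) -> a = 0 /\ b = 0.
Proof.
intros H.
pose proof (H 0) as h0; pose proof (H 1) as h1; pose proof (H (-1)) as h1'.
pose proof (H 2) as h2; pose proof (H (-2)) as h2'.
(* Five equally spaced values of a quartic: the fourth difference isolates its leading coefficient
   [a ^ 2]. *)
assert (haa : a * a = 0) by lra.
assert (ha : a = 0) by (destruct (Rmult_integral _ _ haa); assumption).
rewrite ha in *.
assert (hbb : b * b = 0) by lra.
split; [reflexivity |]; destruct (Rmult_integral _ _ hbb); assumption.
Qed.

(** The non-constant coefficients of the determinant are multiples of the transverse components of
    [w]. The factor is [r * p] up to sign, except in the lightlike model, where it is a constant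
    times [r]. *)
Lemma model_parallel_axis (m : rotation_model) (p r s : R) (w : vec) :
  0 < r -> (m <> lightlike_axis -> p <> 0) ->
  (forall t, det3 (model_u m p r t) (model_v m r t) w ^ 2 = s) ->
  parallel w (model_axis m).
Proof.
intros hr hp H; destruct w as [[w1 w2] w3].
assert (reg : forall x, r * p * x = 0 -> p <> 0 -> x = 0).
{ intros x h h'; destruct (Rmult_integral _ _ h) as [h1 |]; [| assumption].
  destruct (Rmult_integral _ _ h1); [lra | contradiction]. }
destruct m.
(* These are the coefficients of minus the determinant; the square absorbs the sign. *)
- destruct (trig_sqr_const (r * p * w1) (r * p * w2) (- r * w3) s) as [h1 h2].
  { intros t; rewrite <- (H t).
    pose proof (cos_sqr t) as hc.
    unfold det3, vx, vy, vz; simpl fst; simpl snd; ring [hc]. }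
  apply reg in h1; [| now apply hp]; apply reg in h2; [| now apply hp].
  exists w3; apply vec_ext; unfold vx, vy, vz; simpl;
    unfold scal; simpl; unfold mult; simpl; lra.
- destruct (hyp_sqr_const (r * p * w3) (- (r * p * w2)) (- r * w1) s) as [h1 h2].
  { intros t; rewrite <- (H t).
    pose proof (cosh_sqr t) as hc.
    unfold det3, vx, vy, vz; simpl fst; simpl snd; ring [hc]. }
  assert (h2' : r * p * w2 = 0) by lra.
  apply reg in h1; [| now apply hp]; apply reg in h2'; [| now apply hp].
  exists w1; apply vec_ext; unfold vx, vy, vz; simpl;
    unfold scal; simpl; unfold mult; simpl; lra.
- destruct (hyp_sqr_const (- (r * p * w2)) (r * p * w3) (r * w1) s) as [h1 h2].
  { intros t; rewrite <- (H t).
    pose proof (cosh_sqr t) as hc.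
    unfold det3, vx, vy, vz; simpl fst; simpl snd; ring [hc]. }
  assert (h1' : r * p * w2 = 0) by lra.
  apply reg in h1'; [| now apply hp]; apply reg in h2; [| now apply hp].
  exists w1; apply vec_ext; unfold vx, vy, vz; simpl;
    unfold scal; simpl; unfold mult; simpl; lra.
- destruct (quad_sqr_const (2 * r * (w2 - w3)) (- 4 * r * w1)
    (2 * r * ((p - 1) * w2 - (p + 1) * w3)) s) as [h1 h2].
  { intros t; rewrite <- (H t).
    unfold det3, vx, vy, vz; simpl fst; simpl snd; ring. }
  assert (e1 : w2 - w3 = 0)
    by (destruct (Rmult_integral _ _ h1); [lra | assumption]).
  assert (e2 : w1 = 0)
    by (destruct (Rmult_integral _ _ h2); [lra | assumption]).
  exists w2; apply vec_ext; unfold vx, vy, vz; simpl;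
    unfold scal; simpl; unfold mult; simpl; lra.
Qed.

(** * The speed vector of a rotational translator *)

Theorem proposition4p1 :
  forall (alpha : R) (w : vec) (D : R -> R -> Prop) (X : R -> R -> vec)
         (axis : vec),
    alpha <> 0 ->
    rotational_surface D X axis ->
    timelike_translator alpha w D X ->
    parallel w axis.
Proof.
intros alpha w D X axis _ (m & f & I & L & q & (oI & (r & Ir) & posI & _) & sf
  & HL & hD & hX & ->) ((_ & _ & lorX) & N & (sN & hN) & HK).
pose proof HL as [linL _].
pose proof (posI r Ir) as hr.
assert (df : forall s, I s -> is_derive f s (Derive f s)).
{ intros s Is; apply Derive_correct; exact (sf s Is 1%nat). }
assert (ddf : is_derive (Derive f) r (Derive_n f 2 r)).
{ apply Derive_correct; exact (sf r Ir 2%nat). }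
set (p := Derive f r) in *; set (h := Derive_n f 2 r) in *.
(* Needed on all of [I], although only the circle at [r] is studied: orthogonality to [N] is later
   differentiated in the first parameter. *)
assert (Xu : forall s t, I s -> d_u X s t = L (model_u m (Derive f s) s t)).
{ intros s t Is; apply is_vderive_unique.
  apply is_vderive_ext_loc with (fun s => plus (L (model_surface m f s t)) q).
  - generalize (oI s Is); apply filter_imp; intros s' Is'.
    symmetry; apply hX; now apply hD.
  - apply is_vderive_affine, is_vderive_model_u, df; assumption. }
assert (Xv : forall s t, I s -> d_v X s t = L (model_v m s t)).
{ intros s t Is; apply is_vderive_unique.
  apply is_vderive_ext_loc with (fun t => plus (L (model_surface m f s t)) q).
  - apply filter_forall; intros t'.
    symmetry; apply hX; now apply hD.
  - apply is_vderive_affine, is_vderive_model_v; assumption. }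
assert (linder : forall c t l, is_vderive c t l -> is_vderive (fun s => L (c s)) t (L l)).
{ intros c t l hc.
  apply is_vderive_ext_loc with (fun s => plus (L (c s)) zero).
  - apply filter_forall; intros s; apply plus_zero_r.
  - now apply is_vderive_affine. }
assert (Dr : forall t, D r t) by (intros t; now apply hD).
assert (loc : forall P : R -> Prop, (forall s, I s -> P s) -> locally r P).
{ intros P HP; generalize (oI r Ir); now apply filter_imp. }
assert (W : forall t, gram2 (model_u m p r t) (model_v m r t) < 0).
{ intros t; rewrite <- (gram2_isometry L), <- Xv by assumption.
  unfold p; rewrite <- Xu by assumption.
  now apply lorentzian_gram2_neg, lorX. }
(* The determinant formula for K, pulled back by [L]: every determinant gains a factor [ldet L], and
   the Gram determinant is unchanged. *)
assert (curv : forall t K, is_gauss_curvature X N r t K ->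
  K * gram2 (model_u m p r t) (model_v m r t) ^ 2
  = ldet L ^ 2 * model_curvature_numerator m p h r t).
{ intros t K (a & b & c & d & (hu & hv) & ->).
  destruct (hN r t (Dr t)) as (hA & hB & hn).
  rewrite Xu in hu, hv, hA by assumption; rewrite Xv in hu, hv, hB by assumption.
  fold p in hu, hv, hA.
  rewrite hn, Rmult_1_l, <- (gram2_isometry L) by assumption.
  rewrite (gauss_curvature_det3 (N r t) _ _ (d_u N r t) (d_v N r t)
    (L (model_uu m h)) (L (model_uv m t)) (L (model_vv m r t))
    a b c d hA hB hn); try assumption.
  - unfold model_curvature_numerator; rewrite !det3_linear by assumption; ring.
  - rewrite gram2_isometry by assumption; apply Rlt_not_eq, W.
  - apply (is_vderive_orthogonal (fun s => N s t)
      (fun s => L (model_u m (Derive f s) s t)) r).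
    + now apply smooth_on_d_u with D.
    + now apply linder, is_vderive_model_uu.
    + apply loc; intros s Is; rewrite <- Xu by assumption; apply hN; now apply hD.
  - apply (is_vderive_orthogonal (fun s => N s t) (fun s => L (model_v m s t)) r).
    + now apply smooth_on_d_u with D.
    + now apply linder, is_vderive_model_vu.
    + apply loc; intros s Is; rewrite <- Xv by assumption; apply hN; now apply hD.
  - apply (is_vderive_orthogonal (fun s => N r s) (fun s => L (model_u m p r s)) t).
    + now apply smooth_on_d_v with D.
    + now apply linder, is_vderive_model_uv.
    + apply filter_forall; intros s; unfold p; rewrite <- Xu by assumption.
      now apply hN.
  - apply (is_vderive_orthogonal (fun s => N r s) (fun s => L (model_v m r s)) t).
    + now apply smooth_on_d_v with D.
    + now apply linder, is_vderive_model_vv.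
    + apply filter_forall; intros s; rewrite <- Xv by assumption.
      now apply hN. }
destruct (isometry_surjective L w HL) as [w' ->].
pose proof (isometry_ldet_neq0 L HL) as dL.
assert (par : parallel w' (model_axis m)).
{ destruct (HK r 0 (Dr 0)) as (K & hK & Kpos & trK).
  pose proof (curv 0 K hK) as EK.
  (* The constant is [- W * <N,w>^2] with [W = EG - F^2], divided by [ldet L ^ 2] because the
     determinant is taken in model coordinates. *)
  apply (model_parallel_axis m p r
    (- gram2 (model_u m p r 0) (model_v m r 0) * Rpower K alpha ^ 2 / ldet L ^ 2));
    [assumption | |].
  (* Outside the lightlike model the curvature numerator has the factor [p], so [p = 0] would
     contradict [K * W ^ 2 > 0]. *)
  - intros hm p0; rewrite model_curvature_numeratorE, p0 in EK.
    pose proof (W 0) as W0; rewrite p0 in W0.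
    pose proof (Rmult_lt_0_compat _ _ Kpos (pow2_gt_0 _ (Rlt_not_eq _ _ W0))) as pos.
    rewrite EK in pos; destruct m; try lra; now apply hm.
  - intros t; destruct (HK r t (Dr t)) as (K' & hK' & _ & trK').
    pose proof (curv t K' hK') as EK'.
    assert (EW : gram2 (model_u m p r t) (model_v m r t)
                 = gram2 (model_u m p r 0) (model_v m r 0))
      by now rewrite !gram2_model.
    pose proof (W 0) as W0.
    (* Neither [W] nor the numerator depends on [t], so the curvature is constant along the
       circle. *)
    assert (KK : K' = K).
    { apply (Rmult_eq_reg_r (gram2 (model_u m p r 0) (model_v m r 0) ^ 2)).
      - rewrite EK, <- EW, EK', !model_curvature_numeratorE; reflexivity.
      - apply pow_nonzero; lra. }
    rewrite KK in trK'; rewrite trK', <- EW.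
    destruct (hN r t (Dr t)) as (hA & hB & hn).
    rewrite Xu in hA by assumption; rewrite Xv in hB by assumption.
    pose proof (det3_mul_det3 _ _ _ (L w') (L w') hA hB hn) as E.
    fold p in E; rewrite !det3_linear, gram2_isometry in E by assumption.
    apply (Rmult_eq_reg_l (ldet L ^ 2)); [| now apply pow_nonzero].
    transitivity (- gram2 (model_u m p r t) (model_v m r t)
      * (ldot (N r t) (L w') * ldot (N r t) (L w'))); [| field; assumption].
    rewrite <- E; [ring | apply Rlt_not_eq, W]. }
destruct par as [k ->]; exists k; exact (linear_scal L linL k (model_axis m)).
Qed.
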